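(* For $\delta>0$ let $y^\delta\in\mathcal{Y}$ satisfy $\|y-y^\delta\|_{\mathcal{Y}}\le\delta$, and let $\alpha(\delta)>0$ be such that $\alpha(\delta)\to0$ and $\delta^2/\alpha(\delta)\to0$ as $\delta\to0$. Let $\delta_k\to0$, $\alpha_k:=\alpha(\delta_k)$, and let $x_{\alpha_k}^{\delta_k}$ be a solution of the minimization problem $$\min_{x\in\mathcal{D}(F)}\left\{\|F(x)-y^{\delta}\|_{\mathcal{Y}}^2+\|x-x^*\|_{\mathcal{S},\alpha}^2\right\}$$ with $\delta=\delta_k$ and $\alpha=\alpha_k$. Then every such sequence $\{x_{\alpha_k}^{\delta_k}\}$ has a convergent subsequence (in the norm of $L^2(\Omega)$), and the limit of every convergent subsequence is an $x^*$-$\mathcal{S}$-minimum-norm solution. If, in addition, the $x^*$-$\mathcal{S}$-minimum-norm solution $x^\dagger$ is unique, then $$\lim_{\delta\to0}x^{\delta}_{\alpha(\delta)}=x^\dagger ,$$ where $x^\delta_{\alpha(\delta)}$ denotes a solution of the minimization problem $$\min_{x\in\mathcal{D}(F)}\left\{\|F(x)-y^{\delta}\|_{\mathcal{Y}}^2+\|x-x^*\|_{\mathcal{S},\alpha(\delta)}^2\right\}.$$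
   Context: Setting. $\Omega\subset\mathbb{R}^n$ is measurable and bounded, $\mathcal{Y}$ is a Hilbert space, and $F:\mathcal{D}(F)\subset L^2(\Omega)\to\mathcal{Y}$ is a (possibly nonlinear) operator which is continuous and weakly sequentially closed, i.e. if $x_n\in\mathcal{D}(F)$, $x_n\rightharpoonup x$ in $L^2(\Omega)$ and $F(x_n)\rightharpoonup z$ in $\mathcal{Y}$, then $x\in\mathcal{D}(F)$ and $F(x)=z$. $\|\cdot\|_2$ is the $L^2(\Omega)$-norm. $\mathcal{S}\subset\Omega$ is a measurable set; for $x\in L^2(\Omega)$, ''$\mathrm{supp}(x)\subset\mathcal{S}$'' means $x=0$ almost everywhere on $\Omega\setminus\mathcal{S}$. The initial guess $x^*\in L^2(\Omega)$ satisfies $\mathrm{supp}(x^* )\subset\mathcal{S}$. The exact data $y\in\mathcal{Y}$ are fixed. An $x^*$-$\mathcal{S}$-minimum-norm solution is any minimizer of $\|x-x^*\|_2$ over the set of all $x\in\mathcal{D}(F)$ with $F(x)=y$ and $\mathrm{supp}(x)\subset\mathcal{S}$. It is assumed throughout that there is an exact solution $x^\dagger\in\mathcal{D}(F)$ of $F(x^\dagger)=y$ with $\mathrm{supp}(x^\dagger)\subset\mathcal{S}$, and that $x^*$ is such that $x^\dagger$ is an $x^*$-$\mathcal{S}$-minimum-norm solution. For $\alpha>0$ and $x\in L^2(\Omega)$, define $$\|x\|_{\mathcal{S},\alpha}:=\left(\alpha\int_{\mathcal{S}}|x(\lambda)|^2\,d\lambda+\int_{\Omega\setminus\mathcal{S}}|x(\lambda)|^2\,d\lambda\right)^{1/2}.$$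 *)

(* Defs.v *)
From HB Require Import structures.
From mathcomp Require Import all_boot all_order all_algebra.
From mathcomp Require Import all_classical all_reals all_analysis.
Import Order.TTheory GRing.Theory Num.Theory.
Import numFieldNormedType.Exports.

Set Implicit Arguments.
Unset Strict Implicit.
Unset Printing Implicit Defensive.

Local Open Scope classical_set_scope.
Local Open Scope ring_scope.

Section lebesgue_measure_on_Rn.
Context {R : realType} {n : nat}.
Implicit Types (a b : 'rV[R]_n) (A : set 'rV[R]_n).

Definition box a b : set 'rV[R]_n :=
  [set x | forall i, a 0 i <= x 0 i <= b 0 i].

(* The [Num.max] makes the volume vanish when [box a b] is empty. *)
Definition box_volume a b : R := \prod_(i < n) Num.max 0 (b 0 i - a 0 i).

(* Infimum of the total volumes of the countable covers of A by closed boxes.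
   The index set D makes finite covers, and the empty one, available. *)
Definition lebesgue_outer A : \bar R := ereal_inf
  [set s | exists (D : set nat) (a b : nat -> 'rV[R]_n),
     A `<=` \bigcup_(k in D) box (a k) (b k) /\
     s = (\esum_(k in D) (box_volume (a k) (b k))%:E)%E].

Lemma box_volume_ge0 a b : 0 <= box_volume a b.
Proof. by apply: prodr_ge0 => i _; rewrite le_max lexx. Qed.

Lemma lebesgue_outer_ge0 A : (0 <= lebesgue_outer A)%E.
Proof.
apply: le_ereal_inf_tmp => _ [D [a [b [_ ->]]]].
by apply: esum_ge0 => k _; rewrite lee_fin box_volume_ge0.
Qed.

Lemma lebesgue_outer0 : lebesgue_outer set0 = 0%E.
Proof.
apply: le_anti; rewrite lebesgue_outer_ge0 andbT.
apply: ereal_inf_lbound; exists set0, (fun=> 0), (fun=> 0).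
by split; [exact: sub0set|rewrite esum_set0].
Qed.

Lemma le_lebesgue_outer :
  {homo lebesgue_outer : A B / A `<=` B >-> (A <= B)%E}.
Proof.
move=> A B AB; apply/ereal_inf_le_tmp => s [D [a [b [BD sE]]]].
by exists D, a, b; split => //; exact: subset_trans BD.
Qed.

Lemma lebesgue_outer_sigma_subadditive : sigma_subadditive lebesgue_outer.
Proof.
move=> A; have [[i ioo]|] := pselect (exists i, lebesgue_outer (A i) = +oo%E).
  rewrite (eseries_pinfty _ _ ioo) ?leey// => k _.
  by rewrite -ltNye (lt_le_trans _ (lebesgue_outer_ge0 _)).
rewrite -forallNE => Aoo.
suff add2e (e : {posnum R}) : (lebesgue_outer (\bigcup_k A k) <=
    \sum_(i <oo) lebesgue_outer (A i) + e%:num%:E)%E.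
  by apply/lee_addgt0Pr => _/posnumP[].
rewrite (le_trans _ (epsilon_trick _ _ _))//; last first.
  by move=> k; exact: lebesgue_outer_ge0.
pose C := (set nat * ((nat -> 'rV[R]_n) * (nat -> 'rV[R]_n)))%type.
pose v (c : C) k : \bar R := (box_volume (c.2.1 k) (c.2.2 k))%:E.
have v0 c k : (0 <= v c k)%E by rewrite lee_fin box_volume_ge0.
pose P k (c : C) := A k `<=` \bigcup_(j in c.1) box (c.2.1 j) (c.2.2 j) /\
  (\esum_(j in c.1) v c j <=
   lebesgue_outer (A k) + (e%:num / (2 ^ k.+1)%:R)%:E)%E.
have [G PG] : {G : nat -> C & forall k, P k (G k)}.
  apply: (@choice _ _ P) => k; rewrite /P.
  have ek : 0 < e%:num / (2 ^ k.+1)%:R by [].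
  have Afin : lebesgue_outer (A k) \is a fin_num.
    by rewrite ge0_fin_numE ?lebesgue_outer_ge0// ltey; exact/eqP/Aoo.
  have [s [D [a [b [AD ->]]]] sA] := lb_ereal_inf_adherent ek Afin.
  by exists (D, (a, b)); split => //; exact/ltW.
have /card_esym/ppcard_eqP[f] := card_nat2.
pose K := [set p : nat * nat | (G p.1).1 p.2].
apply: (@le_trans _ _ (\esum_(p in K) v (G p.1) p.2)).
  apply: ereal_inf_lbound.
  exists (f @^-1` K), (fun m => (G (f m).1).2.1 (f m).2),
    (fun m => (G (f m).1).2.2 (f m).2); split.
    move=> t [i _ /(PG i).1 [j Dj tj]].
    by exists (f^-1%FUN (i, j)) => /=; rewrite ?invK ?inE.
  rewrite (reindex_esum (f @^-1` K) K f)//.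
  split => //.
  - by move=> x y _ _; apply: inj; rewrite inE.
  - by move=> p Kp; exists (f^-1%FUN p); rewrite /= invK ?inE.
have -> : (\esum_(p in K) v (G p.1) p.2 =
    \sum_(i <oo) \esum_(j in (G i).1) v (G i) j)%E.
  rewrite nneseries_esumT; last by move=> i; exact: esum_ge0.
  rewrite (esum_esum (J := fun i => (G i).1) (a := fun i j => v (G i) j))//.
  congr esum; apply/seteqP; split => [[i j]|[i j]] //=.
  by case.
by apply: lee_nneseries => [i _ _|i _]; [exact: esum_ge0|exact: (PG i).2].
Qed.

HB.instance Definition _ := isOuterMeasure.Build R 'rV[R]_n lebesgue_outer
  lebesgue_outer0 lebesgue_outer_ge0 le_lebesgue_outer
  lebesgue_outer_sigma_subadditive.

End lebesgue_measure_on_Rn.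

(* R^n with the Lebesgue sigma-algebra, i.e. the Caratheodory measurable sets
   of the outer measure, on which the outer measure is a complete measure. *)
Notation Rn R n := (caratheodory_type (@lebesgue_outer R n)).

Definition lebesgue_Rn (R : realType) (n : nat) :
    {measure set (Rn R n) -> \bar R} :=
  let mu : {outer_measure set 'rV[R]_n -> \bar R} := @lebesgue_outer R n in
  (mu : set (caratheodory_type mu) -> \bar R).

Section L2_space.
Context {R : realType} {n : nat} {Omega : set (Rn R n)}.
Variable mOmega : measurable Omega.

(* Lebesgue measure of Omega, as a measure on R^n that does not charge the
   complement of Omega. *)
Definition lebesgue_on : {measure set (Rn R n) -> \bar R} :=
  mrestr (lebesgue_Rn R n) mOmega.

(* Functions on R^n modulo equality almost everywhere on Omega: the values
   outside Omega are irrelevant. *)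
Definition L2 := LspaceType2 lebesgue_on.

Definition L2norm (f : Rn R n -> R) : R :=
  fine ('N[lebesgue_on]_2%:E[EFin \o f])%E.

Definition L2dist (f g : L2) : R := L2norm (fun t => f t - g t).

Definition L2cvg (u : nat -> L2) (x : L2) := L2dist (u k) x @[k --> \oo] --> 0.

Definition L2weak_cvg (u : nat -> L2) (x : L2) := forall g : L2,
  \int[lebesgue_on]_t (u k t * g t) @[k --> \oo] -->
  \int[lebesgue_on]_t (x t * g t).

Definition supported_in (S : set (Rn R n)) (x : L2) :=
  {ae lebesgue_Rn R n, forall t, (Omega `\` S) t -> x t = 0}.

End L2_space.

Arguments L2dist {R n Omega mOmega} f g.
Arguments L2cvg {R n Omega mOmega} u x.
Arguments L2weak_cvg {R n Omega mOmega} u x.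
Arguments supported_in {R n Omega mOmega} S x.

Definition weighted_norm {R : realType} {n : nat} (Omega S : set (Rn R n)) (a : R)
    (f : Rn R n -> R) : R :=
  Num.sqrt (a * \int[lebesgue_Rn R n]_(t in S) (`|f t| ^+ 2) +
            \int[lebesgue_Rn R n]_(t in Omega `\` S) (`|f t| ^+ 2)).

(* Together with completeness of the norm, this makes Y a Hilbert space. *)
Definition norm_from_dot {R : realType} {Y : normedModType R}
  (dot : {dot Y for idfun}) := forall u : Y, `|u| ^+ 2 = dot u u.

Definition weak_cvg {R : realType} {Y : normedModType R}
  (dot : {dot Y for idfun}) (u : nat -> Y) (z : Y) := forall w : Y,
  dot (u k) w @[k --> \oo] --> dot z w.

(* An operator with domain D is a total function of which only the values on D
   are used. *)
Section operator.
Context {R : realType} {n : nat} {Omega : set (Rn R n)}.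
Context {mOmega : measurable Omega} {Y : normedModType R}.
Variables (D : set (L2 mOmega)) (F : L2 mOmega -> Y).

Definition operator_continuous := forall x, D x -> forall e : R, 0 < e ->
  exists2 r : R, 0 < r &
    forall x', D x' -> L2dist x' x < r -> `|F x' - F x| < e.

Definition weakly_sequentially_closed (dot : {dot Y for idfun}) :=
  forall (u : nat -> L2 mOmega) (x : L2 mOmega) (z : Y),
    (forall k, D (u k)) -> L2weak_cvg u x -> weak_cvg dot (F \o u) z ->
    D x /\ F x = z.

Definition supported_solution (y : Y) (S : set (Rn R n)) (x : L2 mOmega) :=
  [/\ D x, F x = y & supported_in S x].

Definition minimum_norm_solution (y : Y) (S : set (Rn R n))
    (xstar x : L2 mOmega) :=
  supported_solution y S x /\
  forall x', supported_solution y S x' -> L2dist x xstar <= L2dist x' xstar.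

Definition tikhonov (yd : Y) (S : set (Rn R n)) (a : R)
    (xstar x : L2 mOmega) : R :=
  `|F x - yd| ^+ 2 +
  weighted_norm Omega S a (fun t => x t - xstar t) ^+ 2.

Definition tikhonov_minimizer (yd : Y) (S : set (Rn R n)) (a : R)
    (xstar x : L2 mOmega) :=
  D x /\
  forall x', D x' -> tikhonov yd S a xstar x <= tikhonov yd S a xstar x'.

End operator.

(* Main.v *)
Require Import Defs.
From mathcomp Require Import all_boot all_order all_algebra.
From mathcomp Require Import all_classical all_reals all_analysis.
From mathcomp Require Import measurable_realfun ring lra.
Import Order.TTheory GRing.Theory Num.Theory.
Import numFieldNormedType.Exports.

Set Implicit Arguments.
Unset Strict Implicit.
Unset Printing Implicit Defensive.

Local Open Scope classical_set_scope.
Local Open Scope ring_scope.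

(** Write z_k = x_k - x^* and r = |x^dag - x^*|^2. Comparing the Tikhonov
    functional at its minimizer x_k and at x^dag, where the part of the penalty
    carried by the complement of S vanishes, gives
      |F x_k - y_k|^2 + alpha_k |z_k|_S^2 + |z_k|_(Omega - S)^2
        <= delta_k^2 + alpha_k r
    ([tikhonov_minimizer_bounds]). Hence the residuals tend to 0, the part of
    z_k outside S tends strongly to 0, and
    |z_k|^2 <= r + delta_k^2 / alpha_k + (delta_k^2 + alpha_k r).
    The sequence is bounded, so that it has a weakly convergent subsequence
    ([minimizers_weak_subseq]). The heart of the proof is
    [weak_limit_minimum_norm]: a weak limit x of such a sequence solves F x = y
    because F is weakly sequentially closed, it is supported in S because the
    outer parts vanish in the limit, and so r <= |x - x^*|^2 by minimality of
    x^dag, while limsup |z_k|^2 <= r. Weak convergence together with convergence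
    of the norms is strong convergence ([radon_riesz]), and x has minimal norm.
    A strong limit of a subsequence is a weak limit, which gives the second
    claim, and convergence of the whole family under uniqueness follows by
    extracting from any sequence that stays away from x^dag.

    The background is the geometry of a Hilbert space, developed for a positive
    semidefinite form on a real vector space for which Cauchy sequences
    converge. It applies to the square integrable functions themselves, before
    the passage to classes modulo almost everywhere equality, as they form a
    vector space on which the integral of a product is only semidefinite.
    Weak sequential compactness ([weak_sequential_compactness]) is obtained for
    all vectors v at once: along an ultrafilter all the numbers <u_k, v>
    converge, the Riesz representation theorem turns the limit into a vector x,
    and a diagonal extraction keeps the values of <u_k, u_j> and <u_k, x>,
    which already determine the weak limit. Completeness of L^2 is [Lfun_complete]. *)

(** * Subsequences and ultrafilters on the natural numbers *)

Lemma increasing_choice (P : nat -> nat -> Prop) :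
  (forall n N, exists2 k, (N < k)%N & P n k) ->
  exists2 phi : nat -> nat,
    {homo phi : i j / (i < j)%N} & forall n, P n (phi n).
Proof.
move=> H.
have [f fP] : {f : nat * nat -> nat &
    forall c, (c.2 < f c)%N /\ P c.1 (f c)}.
  by apply: (@choice _ _ (fun c k => (c.2 < k)%N /\ P c.1 k)) => -[n N];
    have [k] := H n N; exists k.
pose phi := fix phi n :=
  if n is m.+1 then f (m.+1, phi m) else f (0%N, 0%N).
exists phi; last by case=> [|n]; exact: (fP (_, _)).2.
by apply: homo_ltn; [exact: ltn_trans|move=> n; exact: (fP (_, phi n)).1].
Qed.

Lemma not_cvg_subseq (R : realType) (d : nat -> R) :
  ~ (d k @[k --> \oo] --> 0) ->
  exists2 phi : nat -> nat, {homo phi : i j / (i < j)%N} &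
    exists2 e : R, 0 < e & forall n, e <= `|d (phi n)|.
Proof.
move=> nd.
have [e e0 eP] : exists2 e : R, 0 < e &
    forall N, exists2 k, (N < k)%N & e <= `|d k|.
  apply: contrapT => /forall2NP H; apply: nd; apply/cvgr0Pnorm_lt => e e0.
  have [//|] := H e.
  move/existsNP => [N /forall2NP HN]; exists N.+1 => // k /= Nk.
  by have [//|/negP] := HN k; rewrite -ltNge.
have [phi phi_homo phiP] := @increasing_choice (fun _ k => e <= `|d k|) (fun=> eP).
by exists phi => //; exists e.
Qed.

Lemma homo_cvg_oo (phi : nat -> nat) :
  {homo phi : i j / (i < j)%N} -> phi k @[k --> \oo] --> \oo.
Proof.
move=> h A [N _ NA]; exists N => // k /= Nk; apply: NA => /=.
apply: (leq_trans Nk); elim: k {Nk} => // k IH.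
by apply: leq_ltn_trans IH _; exact: h.
Qed.

Lemma cvg_comp_homo (T : topologicalType) (u : nat -> T) (l : T) (phi : nat -> nat) :
  {homo phi : i j / (i < j)%N} -> u k @[k --> \oo] --> l ->
  u (phi k) @[k --> \oo] --> l.
Proof. by move=> /homo_cvg_oo h; exact: cvg_comp. Qed.

Lemma ultra_bounded_cvg (R : realType) (U : set_system nat) (UU : UltraFilter U)
    (g : nat -> R) (M : R) :
  (forall k, `|g k| <= M) -> exists l : R, g k @[k --> U] --> l.
Proof.
move=> gM.
have gU : U (g @^-1` `[- M, M]%classic).
  by apply: filterE => k /=; rewrite in_itv/= -ler_norml; exact: gM.
have [l [_ lP]] := @segment_compact R (- M) M _ (fmap_proper_filter _ _) gU.
exists l; apply/cvgrPdist_lt => /= e e0.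
(* an ultrafilter contains a set or its complement: a cluster point is a limit *)
have [//|Ue] := in_ultra_setVsetC [set k | `|l - g k| < e] UU.
have [] := lP [set r | e <= `|l - r|] (ball l e).
- by rewrite /fmap/=; apply: filterS Ue => k /= /negP; rewrite -leNgt.
- exact: nbhsx_ballx.
by move=> r /=[]; rewrite leNgt => /negP.
Qed.

(** If g does not converge, it stays away from l along some subsequence, and an
    ultrafilter finer than the tails of that subsequence is a counterexample. *)
Lemma ultra_cvg_oo (R : realType) (g : nat -> R) (l : R) :
  (forall U : set_system nat, UltraFilter U -> \oo `<=` U ->
     g k @[k --> U] --> l) ->
  g k @[k --> \oo] --> l.
Proof.
move=> H; suff : (g k - l) @[k --> \oo] --> 0 by move/cvg_sub0; apply; exact: cvg_cst.
apply: contrapT => /not_cvg_subseq[phi phi_homo [e e0 eP]].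
have [U [UU sU]] := @ultraFilterLemma _ (phi k @[k --> \oo]) _.
have /cvgrPdist_lt/(_ e e0) Ue := H U UU (subset_trans (homo_cvg_oo phi_homo) sU).
have /sU Ue' : (phi k @[k --> \oo]) [set k | e <= `|g k - l|].
  by rewrite /fmap/=; apply: filterE => k /=; exact: eP.
have [k [/= k1 k2]] := @filter_ex _ U _ _ (filterI Ue Ue').
by move: k2; rewrite distrC leNgt k1.
Qed.

(** For each n, the indices at which g_0, ..., g_n are within 1 / (n + 1)
    of their limits form a set of the ultrafilter, hence an unbounded set, since
    the ultrafilter refines the tails of nat: phi n is picked there. *)
Lemma ultra_diagonal (R : realType) (U : set_system nat) (UU : UltraFilter U)
    (g : nat -> nat -> R) (l : nat -> R) :
  \oo `<=` U -> (forall j, g j k @[k --> U] --> l j) ->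
  exists2 phi : nat -> nat, {homo phi : i j / (i < j)%N} &
    forall j, g j (phi n) @[n --> \oo] --> l j.
Proof.
move=> ooU gl.
have [n N|phi phi_homo phiP] := @increasing_choice
    (fun n k => forall j, (j <= n)%N -> `|l j - g j k| < n.+1%:R^-1).
  have Un : U [set k | forall j, (j <= n)%N -> `|l j - g j k| < n.+1%:R^-1].
    have H j : U [set k | `|l j - g j k| < n.+1%:R^-1].
      by have /cvgrPdist_lt := gl j; apply; rewrite invr_gt0.
    have h : U [set k | forall i : 'I_n.+1, `|l i - g i k| < n.+1%:R^-1].
      by apply: (@filter_forall _ _ (fun i : 'I_n.+1 =>
        [set k | `|l i - g i k| < n.+1%:R^-1]) U) => i; exact: H.
    apply: filterS h => k kP j jn; exact: (kP (Ordinal (jn : (j < n.+1)%N))).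
  have UN : U [set k | (N < k)%N] by apply: ooU; exists N.+1.
  by have [k [? ?]] := @filter_ex _ U _ _ (filterI UN Un); exists k.
exists phi => // j; apply/cvgrPdist_lt => /= e e0.
have : \forall n \near \oo, n.+1%:R^-1 < e.
  exact: near_infty_natSinv_lt (PosNum e0).
move=> He; near=> n.
apply: lt_trans (phiP n j _) _; first by near: n; exists j.
by near: n.
Unshelve. all: by end_near. Qed.

(** * Hilbert space geometry for a semidefinite form *)

(** Only semidefinite: ip u u = 0 holds for a function u that vanishes almost
    everywhere. *)
Record semi_dot (R : realType) (V : lmodType R) (ip : V -> V -> R) : Prop :=
  SemiDot {
    sdotC : forall u v, ip u v = ip v u;
    sdotP : forall a u w v, ip (a *: u + w) v = a * ip u v + ip w v;
    sdot_ge0 : forall u, 0 <= ip u u }.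

Section semi_dot_theory.
Context (R : realType) (V : lmodType R) (ip : V -> V -> R).
Hypothesis ipP : semi_dot ip.

Lemma sdotDl u w v : ip (u + w) v = ip u v + ip w v.
Proof. by rewrite -[u]scale1r (sdotP ipP) mul1r scale1r. Qed.

Lemma sdot0l v : ip 0 v = 0.
Proof.
by have := sdotDl 0 0 v; rewrite addr0 => /eqP; rewrite -subr_eq subrr => /eqP.
Qed.

Lemma sdotZl a u v : ip (a *: u) v = a * ip u v.
Proof. by rewrite -[a *: u]addr0 (sdotP ipP) sdot0l addr0. Qed.

Lemma sdotBl u w v : ip (u - w) v = ip u v - ip w v.
Proof. by rewrite sdotDl -scaleN1r sdotZl mulN1r. Qed.

Lemma sdotDr u v w : ip v (u + w) = ip v u + ip v w.
Proof. by rewrite (sdotC ipP) sdotDl !(sdotC ipP v). Qed.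

Lemma sdotZr a u v : ip v (a *: u) = a * ip v u.
Proof. by rewrite (sdotC ipP) sdotZl (sdotC ipP v). Qed.

Lemma sdotBr u v w : ip v (u - w) = ip v u - ip v w.
Proof. by rewrite (sdotC ipP) sdotBl !(sdotC ipP v). Qed.

Lemma sdot_sqrB u v : ip (u - v) (u - v) = ip u u - 2 * ip u v + ip v v.
Proof. by rewrite sdotBl !sdotBr (sdotC ipP v u); ring. Qed.

Lemma cauchy_schwarz u v : ip u v ^+ 2 <= ip u u * ip v v.
Proof.
have H t : 0 <= ip u u + 2 * t * ip u v + t ^+ 2 * ip v v.
  have := sdot_ge0 ipP (u + t *: v).
  rewrite sdotDl !sdotDr !sdotZl !sdotZr (sdotC ipP v u).
  by rewrite /is_true => <-; congr (_ <= _); ring.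
have := sdot_ge0 ipP u; have := sdot_ge0 ipP v; move: H.
move: (ip u u) (ip u v) (ip v v) => a b c H; rewrite le_eqVlt => /predU1P[c0|c0] a0.
  rewrite -c0 mulr0.
  have /eqP -> : b == 0.
    rewrite -sqrf_eq0 eq_le sqr_ge0 andbT leNgt; apply/negP => b0.
    (* the quadratic polynomial is affine, and takes the value - 1 at this point *)
    have := H (- (a + 1) / (2 * b)); rewrite -c0 mulr0 addr0.
    suff -> : a + 2 * (- (a + 1) / (2 * b)) * b = - 1 by lra.
    by field; apply: contraTneq b0 => ->; rewrite expr0n ltxx.
  by rewrite expr0n.
(* the minimum of the quadratic polynomial *)
have := H (- b / c).
have -> : a + 2 * (- b / c) * b + (- b / c) ^+ 2 * c = (a * c - b ^+ 2) / c.
  by field; rewrite gt_eqF.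
by rewrite pmulr_lge0 ?invr_gt0// subr_ge0.
Qed.

Lemma normr_sdot_le u v : `|ip u v| <= Num.sqrt (ip u u) * Num.sqrt (ip v v).
Proof.
rewrite -sqrtrM ?(sdot_ge0 ipP)// -sqrtr_sqr; apply: ler_wsqrtr.
exact: cauchy_schwarz.
Qed.

Lemma sdot_null u v : ip u u = 0 -> ip u v = 0.
Proof.
move=> u0; apply/eqP; rewrite -sqrf_eq0 eq_le sqr_ge0 andbT.
by apply: le_trans (cauchy_schwarz u v) _; rewrite u0 mul0r.
Qed.

Lemma cvg_sdotl (u : nat -> V) x v :
  ip (u k - x) (u k - x) @[k --> \oo] --> 0 ->
  ip (u k) v @[k --> \oo] --> ip x v.
Proof.
move=> ux.
have H : Num.sqrt (ip (u k - x) (u k - x)) * Num.sqrt (ip v v) @[k --> \oo] --> 0.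
  rewrite -[X in _ --> X](mul0r (Num.sqrt (ip v v))) -sqrtr0.
  apply: cvgM; last exact: cvg_cst.
  by apply: (cvg_comp _ _ ux); exact: sqrt_continuous.
apply: (cvg_sub0 _ (cvg_cst (ip x v))).
apply: norm_cvg0.
apply: (squeeze_cvgr _ (cvg_cst 0) H).
apply: filterE => k /=; rewrite normr_ge0 /=.
have := normr_sdot_le (u k - x) v; by rewrite [in X in X -> _]sdotBl.
Qed.

Lemma sdot_cvg_null (u : nat -> V) : ip (u k) (u k) @[k --> \oo] --> 0 ->
  forall v, ip (u k) v @[k --> \oo] --> 0.
Proof.
move=> u0 v; rewrite -(sdot0l v); apply: cvg_sdotl.
by under eq_fun do rewrite subr0.
Qed.

(** Expand <u_k - x, u_k - x>: its upper limit is at most r - <x, x>, which is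
    nonpositive by hypothesis, whereas it is nonnegative. *)
Lemma radon_riesz (u : nat -> V) x (r : R) (eps : nat -> R) :
  (forall v, ip (u k) v @[k --> \oo] --> ip x v) ->
  (forall k, ip (u k) (u k) <= r + eps k) -> eps k @[k --> \oo] --> 0 ->
  r <= ip x x ->
  ip x x = r /\ ip (u k - x) (u k - x) @[k --> \oo] --> 0.
Proof.
move=> ux ur eps0 rx.
have ub k : ip (u k - x) (u k - x) <= r + eps k - 2 * ip (u k) x + ip x x.
  by rewrite sdot_sqrB lerD2r lerD2r.
have ub_cvg : r + eps k - 2 * ip (u k) x + ip x x @[k --> \oo] -->
    r + 0 - 2 * ip x x + ip x x.
  apply: cvgD; last exact: cvg_cst.
  apply: cvgB; first by apply: cvgD => //; exact: cvg_cst.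
  by apply: cvgM; [exact: cvg_cst|exact: ux].
have xr : ip x x = r.
  apply/eqP; rewrite eq_le rx andbT.
  have : 0 <= r + 0 - 2 * ip x x + ip x x.
    apply: (ler_cvg_to (cvg_cst 0) ub_cvg); apply: filterE => k.
    by apply: le_trans (ub k); exact: sdot_ge0 ipP _.
  lra.
split=> //; move: ub_cvg; rewrite xr (_ : r + 0 - 2 * r + r = 0); last by ring.
move=> h; apply: (squeeze_cvgr _ (cvg_cst 0) h); apply: filterE => k.
by rewrite (sdot_ge0 ipP) -{2}xr ub.
Qed.

(** Since ip is only semidefinite, limits are not unique, but two limits of the
    same sequence have the same product with every vector. *)
Definition sdot_complete := forall u : nat -> V,
  (forall e : R, 0 < e -> exists N, forall i j, (N <= i)%N -> (N <= j)%N ->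
    ip (u i - u j) (u i - u j) < e) ->
  exists x, ip (u k - x) (u k - x) @[k --> \oo] --> 0.

Hypothesis ip_complete : sdot_complete.

(** A representative of ell is a minimizer of J v = <v, v> - 2 ell v, which is
    bounded below by - M. The parallelogram identity makes minimizing sequences
    Cauchy; at a limit x, the first variation <x, v> - ell v of J vanishes. *)
Lemma riesz (ell : V -> R) (M : R) : 0 <= M ->
  (forall a u w, ell (a *: u + w) = a * ell u + ell w) ->
  (forall v, ell v ^+ 2 <= M * ip v v) ->
  exists x, forall v, ip x v = ell v.
Proof.
move=> M0 ellP ellM; pose J v := ip v v - 2 * ell v.
have J_ge v : - M <= J v.
  have := ellM v; have := sdot_ge0 ipP v; rewrite /J.
  move: (ip v v) (ell v) => q l q0 lq.
  rewrite leNgt; apply/negP => h.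
  have : 0 < (2 * l - (q + M)) * (2 * l + (q + M)) by apply: mulr_gt0; lra.
  have := sqr_ge0 (q - M); nra.
have Jinf : has_inf (range J).
  by split; [exists (J 0), 0|exists (- M) => _ [v _ <-]].
pose m := inf (range J).
have m_le v : m <= J v by apply: ge_inf; [exact: Jinf.2|exists v].
have [u uP] : {u : nat -> V & forall k, J (u k) < m + k.+1%:R^-1}.
  apply: (@choice _ _ (fun k v => J v < m + k.+1%:R^-1)) => k.
  have k0 : 0 < k.+1%:R^-1 :> R by rewrite invr_gt0.
  by have [_ [v _ <-] vP] := inf_adherent k0 Jinf; exists v.
have ell_add v w : ell (v + w) = ell v + ell w.
  by rewrite -[v]scale1r ellP mul1r scale1r.
have ell0 : ell 0 = 0.
  by have /eqP := ell_add 0 0; rewrite addr0 -subr_eq subrr => /eqP.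
have ellZ a v : ell (a *: v) = a * ell v.
  by rewrite -[a *: v]addr0 ellP ell0 addr0.
have parallelogram v w :
    ip (v - w) (v - w) = 2 * J v + 2 * J w - 4 * J (2^-1 *: (v + w)).
  rewrite /J sdot_sqrB sdotZl sdotZr sdotDl !sdotDr ellZ ell_add (sdotC ipP w v).
  by field.
have [|x ux] := ip_complete (u := u).
  move=> e e0; have e4 : 0 < e / 4 by rewrite divr_gt0.
  have [N _ NP] := near_infty_natSinv_lt (PosNum e4).
  exists N => i j Ni Nj; rewrite parallelogram.
  have := NP _ Ni; have := NP _ Nj; have := uP i; have := uP j => /=.
  have := m_le (2^-1 *: (u i + u j)).
  move: (J (2^-1 *: _)) (J (u i)) (J (u j)) (i.+1%:R^-1) (j.+1%:R^-1) => *; lra.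
exists x => v; apply/eqP; rewrite -subr_eq0; apply/eqP.
have H t : 0 <= t * (2 * (ip x v - ell v)) + t ^+ 2 * ip v v.
  have cvgl : t * (2 * (ip (u k) v - ell v)) + t ^+ 2 * ip v v @[k --> \oo] -->
              t * (2 * (ip x v - ell v)) + t ^+ 2 * ip v v.
    apply: cvgD; last exact: cvg_cst.
    do 2 (apply: cvgM; first exact: cvg_cst).
    by apply: cvgB; [exact: cvg_sdotl|exact: cvg_cst].
  have cvgh : - k.+1%:R^-1 @[k --> \oo] --> (0 : R).
    by rewrite -oppr0; apply: cvgN; exact: cvg_harmonic.
  apply: (ler_cvg_to cvgh cvgl); apply: filterE => k.
  have := uP k; have := m_le (u k + t *: v).
  rewrite /J sdotDl !sdotDr !sdotZl !sdotZr ell_add ellZ (sdotC ipP v).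
  move=> /= h1 h2; move: h1 h2.
  move: (ip (u k) (u k)) (ip (u k) v) (ip v v) (ell (u k)) (ell v) (k.+1%:R^-1).
  by move: (m) => m0 *; lra.
have := sdot_ge0 ipP v; move: (ip x v - ell v) (ip v v) H => b c H c0.
apply/eqP; rewrite -sqrf_eq0 eq_le sqr_ge0 andbT.
(* the shift keeps the denominator positive when c = 0 *)
have c1 : 0 < c + 2 by lra.
have := H (- b / (c + 2)).
have -> : - b / (c + 2) * (2 * b) + (- b / (c + 2)) ^+ 2 * c =
    - b ^+ 2 * ((c + 4) / (c + 2) ^+ 2).
  by field; rewrite gt_eqF.
rewrite mulNr oppr_ge0 pmulr_lle0// divr_gt0// ?exprn_gt0//; lra.
Qed.

(** By Cauchy-Schwarz each v |-> <u_k, v> is bounded, so that it converges along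
    the ultrafilter; the limit is linear and bounded in v. *)
Lemma ultra_weak_limit (U : set_system nat) (UU : UltraFilter U)
    (u : nat -> V) (M : R) :
  (forall k, ip (u k) (u k) <= M) ->
  exists x, forall v, ip (u k) v @[k --> U] --> ip x v.
Proof.
move=> uM; have M0 : 0 <= M by apply: le_trans (uM 0%N); exact: sdot_ge0 ipP _.
have [ell ellP] : {ell : V -> R & forall v, ip (u k) v @[k --> U] --> ell v}.
  apply: (@choice _ _ (fun v l => ip (u k) v @[k --> U] --> l)) => v.
  apply: (ultra_bounded_cvg UU (M := Num.sqrt M * Num.sqrt (ip v v))) => k.
  apply: le_trans (normr_sdot_le _ _) _.
  by rewrite ler_wpM2r ?sqrtr_ge0// ler_wsqrtr.
have [|v|x xP] := @riesz ell M M0; last by exists x => v; rewrite xP.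
- move=> a v w; apply: (cvg_unique (@norm_hausdorff _ R) (ellP (a *: v + w))).
  rewrite /=; under eq_fun => k do rewrite sdotDr sdotZr.
  by apply: cvgD; [apply: cvgM; [exact: cvg_cst|]|]; exact: ellP.
- apply: (ler_cvg_to (cvgM (ellP v) (ellP v)) (cvg_cst (M * ip v v))).
  apply: filterE => k; apply: le_trans (cauchy_schwarz _ _) _.
  by rewrite ler_wpM2r// (sdot_ge0 ipP).
Qed.

(** Let x be the weak limit along an ultrafilter, and let phi be such that
    <u_phi(k), w> tends to <x, w> for w = x and for all the w = u_j. Any weak limit
    y of u o phi along an ultrafilter then has <y, w> = <x, w> for these w. As
    <u_phi(k), y> = <u_phi(k), x>, passing to the limit gives <y, y> = <y, x>,
    hence <x - y, x - y> = 0. All these limits are the same, that is, u o phi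
    converges weakly to x. *)
Lemma weak_sequential_compactness (u : nat -> V) (M : R) :
  (forall k, ip (u k) (u k) <= M) ->
  exists2 phi : nat -> nat, {homo phi : i j / (i < j)%N} &
    exists x, forall v, ip (u (phi k)) v @[k --> \oo] --> ip x v.
Proof.
move=> uM; have [U [UU ooU]] := @ultraFilterLemma nat \oo _.
have [x xP] := ultra_weak_limit UU uM.
pose w j := if j is i.+1 then u i else x.
have [phi phi_homo phiP] := ultra_diagonal UU
  (g := fun j k => ip (u k) (w j)) ooU (fun j => xP (w j)).
exists phi => //; exists x => v; apply: ultra_cvg_oo => W WU ooW.
have [y yP] := ultra_weak_limit WU (u := u \o phi) (fun k => uM (phi k)).
have yw j : ip y (w j) = ip x (w j).
  apply: (cvg_unique (@norm_hausdorff _ R) (yP _)) => A hA.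
  by apply: ooW; exact: phiP hA.
have yy : ip y y = ip x x.
  rewrite -(yw 0%N) /w; apply: (cvg_unique (@norm_hausdorff _ R) (yP y)).
  have -> : (fun k => ip ((u \o phi) k) y) = (fun k => ip ((u \o phi) k) x).
    apply/funext => k.
    exact: etrans (sdotC ipP _ _) (etrans (yw (phi k).+1) (sdotC ipP _ _)).
  exact: yP.
have xy : ip (x - y) (x - y) = 0.
  by rewrite sdot_sqrB (sdotC ipP x y) (yw 0%N) yy /w; ring.
have -> : ip x v = ip y v.
  by apply/eqP; rewrite -subr_eq0 -sdotBl (sdot_null _ xy).
exact: yP.
Qed.

End semi_dot_theory.

(** * The square integrable functions of a measure space *)

Section L2_form.
Context d (T : measurableType d) (R : realType).
Variable mu : {measure set T -> \bar R}.
Local Notation V := (LfunType mu (lee1n 2)).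

Lemma mem_Lfun2 (f : T -> R) : measurable_fun setT f ->
  (\int[mu]_t (f t ^+ 2)%R%:E < +oo)%E -> f \in Lfun mu 2%:E.
Proof.
move=> mf f2; rewrite inE; apply/andP; split; rewrite inE//=.
rewrite /finite_norm unlock poweR_lty//.
rewrite (le_lt_trans _ f2)// le_eqVlt; apply/orP; left; apply/eqP.
by apply: eq_integral => t _ /=; rewrite powR_mulrn// real_normK ?num_real.
Qed.

Definition Lfun_dot (f g : V) : R := \int[mu]_t (f t * g t).

Lemma Lfun_mul_integrable (f g : V) :
  mu.-integrable setT (EFin \o (fun t => f t * g t)).
Proof. by apply/Lfun1_integrable/Lfun2_mul_Lfun1; exact: LfunP. Qed.

Lemma Lfun_dotE (f g : V) :
  (Lfun_dot f g)%:E = (\int[mu]_t (f t * g t)%R%:E)%E.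
Proof.
by rewrite /Lfun_dot fineK// (integrable_fin_num _ (Lfun_mul_integrable f g)).
Qed.

Lemma semi_dot_Lfun : semi_dot Lfun_dot.
Proof.
split.
- by move=> f g; apply: eq_Rintegral => t _; rewrite mulrC.
- move=> a f h g; rewrite /Lfun_dot.
  rewrite -RintegralZl//; last exact: Lfun_mul_integrable.
  rewrite -RintegralD//; last 2 first.
  + rewrite (_ : _ \o _ = (fun t => a%:E * (f t * g t)%R%:E)%E)//.
    by apply: integrableZl => //; exact: Lfun_mul_integrable.
  + exact: Lfun_mul_integrable.
  by apply: eq_Rintegral => t _; rewrite mulrA -mulrDl.
- by move=> f; apply: Rintegral_ge0 => t _; rewrite -expr2 sqr_ge0.
Qed.

(** With w_k = v_(k+1) - v_k, the inequality 2 |w_k| <= 2^-k + 2^k w_k^2 makes the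
    series of the increments absolutely convergent. *)
Lemma cvg_of_weighted_increments (v : nat -> R) (c : R) :
  (forall n, \sum_(0 <= k < n) 2 ^+ k * (v k.+1 - v k) ^+ 2 <= c) ->
  cvgn v.
Proof.
move=> vc; pose w k := v k.+1 - v k.
have : cvgn (series w).
  apply: normed_cvg; apply: nondecreasing_is_cvgn.
    by apply: nondecreasing_series => k _ _ /=; exact: normr_ge0.
  exists ((1 / (1 - 2^-1) + c) / 2) => _ [n _ <-]; rewrite /series/=.
  have h : series (geometric 1 2^-1) n <= 1 / (1 - 2^-1) :> R.
    by apply: geometric_le_lim => //; rewrite ger0_norm//; lra.
  apply: (@le_trans _ _ ((series (geometric 1 2^-1) n +
    \sum_(0 <= k < n) 2 ^+ k * (v k.+1 - v k) ^+ 2) / 2)); last first.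
    by rewrite ler_wpM2r// lerD.
  rewrite /series/= -big_split/= mulr_suml; apply: ler_sum => k _.
  rewrite -/(w k) mul1r exprVn -[w k ^+ 2]real_normK ?num_real//.
  have k0 : 0 < 2 ^+ k :> R by rewrite exprn_gt0.
  rewrite -subr_ge0 (_ : _ - _ = (2 ^+ k)^-1 / 2 * (1 - 2 ^+ k * `|w k|) ^+ 2).
    by rewrite mulr_ge0 ?sqr_ge0// divr_ge0// invr_ge0 ltW.
  by field; rewrite gt_eqF.
move=> h; have -> : v = fun n => v 0%N + series w n.
  by apply/funext => n; rewrite /series/= telescope_sumr// addrC subrK.
by apply: is_cvgD => //; exact: is_cvg_cst.
Qed.

(** Riesz-Fischer theorem. A subsequence v whose increments have squared norm at
    most 4^-k satisfies the hypothesis of [cvg_of_weighted_increments] at almost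
    every point, as the sum over k of 2^k (v_(k+1) - v_k)^2 is integrable. The
    pointwise limit h is a limit in norm by Fatou's lemma. *)
Lemma Lfun_complete : sdot_complete Lfun_dot.
Proof.
have ipP := semi_dot_Lfun.
move=> u uC.
have [phi phi_homo phiP] : exists2 phi : nat -> nat,
    {homo phi : i j / (i < j)%N} & forall n, forall i j,
      (phi n <= i)%N -> (phi n <= j)%N ->
      Lfun_dot (u i - u j) (u i - u j) < (4 ^+ n)^-1.
  apply: (@increasing_choice (fun n k => forall i j,
      (k <= i)%N -> (k <= j)%N ->
      Lfun_dot (u i - u j) (u i - u j) < (4 ^+ n)^-1)) => n N.
  have [|K KP] := uC (4 ^+ n)^-1; first by rewrite invr_gt0 exprn_gt0.
  exists (maxn N.+1 K); first by rewrite leq_max ltnSn.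
  by move=> i j; rewrite !geq_max => /andP[_ Ki] /andP[_ Kj]; exact: KP.
pose v k : V := u (phi k).
pose e (k : nat) (t : T) : R := 2 ^+ k * (v k.+1 t - v k t) ^+ 2.
have e0 k t : 0 <= e k t by apply: mulr_ge0; [exact: exprn_ge0|exact: sqr_ge0].
have me k : measurable_fun [set: T] (EFin \o e k).
  by apply/measurable_EFinP; apply: measurable_funM => //;
    apply: measurable_funX; apply: measurable_funB.
have int_e k : (\int[mu]_t (e k t)%:E <= ((2 ^+ k)^-1)%:E)%E.
  have -> : (\int[mu]_t (e k t)%:E =
      (2 ^+ k * Lfun_dot (v k.+1 - v k) (v k.+1 - v k))%:E)%E.
    rewrite EFinM Lfun_dotE -integralZl//; last exact: Lfun_mul_integrable.
  rewrite lee_fin (_ : (2 ^+ k)^-1 = 2 ^+ k * (4 ^+ k)^-1).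
    rewrite ler_wpM2l ?exprn_ge0//; apply/ltW/phiP => //.
    by apply/ltnW/phi_homo.
  rewrite (_ : 4 = 2 * 2) ?exprMn; last by ring.
  by field; rewrite expf_neq0.
have int_G : (\int[mu]_t (\sum_(0 <= k <oo) (e k t)%:E) < +oo)%E.
  rewrite integral_nneseries//; last by move=> k t _; rewrite lee_fin e0.
  apply: (@le_lt_trans _ _ (2%:E)); last exact: ltry.
  apply: lime_le.
    apply: is_cvg_nneseries => k _ _.
    by apply: integral_ge0 => t _; rewrite lee_fin e0.
  apply: filterE => n; apply: (@le_trans _ _ ((\sum_(0 <= k < n) (2 ^+ k)^-1)%:E)).
    by rewrite -sumEFin; apply: lee_sum => k _; exact: int_e.
  rewrite lee_fin (@le_trans _ _ (1 / (1 - 2^-1)))//; last by rewrite ler_pdivrMr; lra.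
  have <- : series (geometric 1 2^-1) n = \sum_(0 <= k < n) (2 ^+ k)^-1 :> R.
    by apply: eq_bigr => k _ /=; rewrite mul1r exprVn.
  by apply: geometric_le_lim => //; rewrite ger0_norm//; lra.
pose G t := (\sum_(0 <= k <oo) (e k t)%:E)%E.
have G0 t : (0 <= G t)%E by apply: nneseries_ge0 => k _ _; rewrite lee_fin e0.
have iG : mu.-integrable setT G.
  apply/integrableP; split.
    by apply: (@ge0_emeasurable_sum _ _ _ _ (fun k t => (e k t)%:E) xpredT) =>
      [k t _ _|k _]; [rewrite lee_fin e0|exact: me].
  by under eq_integral => t _ do rewrite gee0_abs//.
(* the upper limit is measurable and equals the limit wherever the latter exists *)
pose h t := fine (limn_esup (fun k => (v k t)%:E)).
have mh : measurable_fun setT h.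
  apply: (measurableT_comp (@fine_measurable R setT measurableT)).
  by apply: measurable_fun_limn_esup => k; exact/measurable_EFinP.
have v_cvg : {ae mu, forall t, v k t @[k --> \oo] --> h t}.
  apply: filterS (integrable_ae measurableT iG) => t /(_ I) Gt.
  have /cvg_ex[l vl] : cvgn (v^~ t).
    apply: (@cvg_of_weighted_increments _ (fine (G t))) => n.
    rewrite -lee_fin fineK// -sumEFin.
    by apply: nneseries_lim_ge => k _ _; rewrite lee_fin e0.
  suff -> : h t = l by [].
  have vlE : (v k t)%:E @[k --> \oo] --> l%:E by apply: cvg_EFin => //; exact: nearW.
  by rewrite /h (cvg_limn_einf_sup vlE).2.
have le_phi k : (k <= phi k)%N.
  by elim: k => // k IH; apply: leq_ltn_trans IH _; exact: phi_homo.
have key (r : R) : 0 < r -> exists N, forall n, (N <= n)%N ->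
    (\int[mu]_t ((h t - u n t) ^+ 2)%R%:E <= r%:E)%E.
  move=> r0; have [N NP] := uC _ r0; exists N => n Nn.
  (* starting at N, every term v (N + m) is within r of u n *)
  pose f m t := ((v (N + m)%N t - u n t) ^+ 2)%:E.
  have mf m : measurable_fun setT (f m).
    by apply/measurable_EFinP/measurable_funX/measurable_funB.
  have f0 m t : setT t -> (0 <= f m t)%E by rewrite lee_fin sqr_ge0.
  have -> : (\int[mu]_t ((h t - u n t) ^+ 2)%R%:E =
             \int[mu]_t limn_einf (f^~ t))%E.
    apply: ge0_ae_eq_integral => //.
    - by apply/measurable_EFinP/measurable_funX/measurable_funB.
    - rewrite (_ : (fun t => _) = (fun t => - limn_esup (fun m => - f m t))%E).
        apply: measurableT_comp => //; apply: measurable_fun_limn_esup => m.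
        exact: measurableT_comp.
      by apply/funext => t; rewrite -limn_einfN; congr limn_einf;
        apply/funext => m; exact: (esym (oppeK _)).
    - by move=> t _; rewrite lee_fin sqr_ge0.
    - move=> t _; rewrite limn_einf_lim; apply: lime_ge; first exact: is_cvg_einfs.
      by apply: filterE => m; apply: le_ereal_inf_tmp => _ [k _ <-]; exact: f0.
    apply: filterS v_cvg => t vt _; apply/esym.
    suff : f m t @[m --> \oo] --> ((h t - u n t) ^+ 2)%:E.
      by move/cvg_limn_einf_sup => [].
    apply: cvg_EFin; first exact: nearW.
    have vt' : v (N + m)%N t @[m --> \oo] --> h t.
      by apply: (cvg_comp_homo (phi := addn N)) vt => i j; rewrite ltn_add2l.
    have vu : v (N + m)%N t - u n t @[m --> \oo] --> h t - u n t.
      by apply: cvgB vt' _; exact: cvg_cst.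
    exact: (cvgM vu vu).
  apply: (le_trans (fatou mu measurableT mf f0)).
  rewrite limn_einf_lim; apply: lime_le; first exact: is_cvg_einfs.
  apply: filterE => m; apply: (@le_trans _ _ (\int[mu]_t f m t)%E).
    by apply: ereal_inf_lbound; exists m => /=.
  rewrite (_ : integral _ _ _ = (Lfun_dot (v (N + m)%N - u n) (v (N + m)%N - u n))%:E).
    rewrite lee_fin ltW// NP// (leq_trans _ (le_phi _))//; exact: leq_addr.
  by rewrite Lfun_dotE; apply: eq_integral => t _; rewrite /f expr2.
have hL : h \in Lfun mu 2%:E.
  have [N NP] := key 1 ltr01.
  rewrite (_ : h = (fun t => h t - u N t) + (u N : T -> R)); last first.
    by apply/funext => t /=; rewrite /GRing.add/= subrK.
  apply: (Lfun_addr_closed mu (lee1n 2)).2; last exact: LfunP.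
  apply: mem_Lfun2; first exact: measurable_funB.
  by apply: le_lt_trans (NP _ (leqnn N)) _; exact: ltry.
pose x : V := Lfun_Sub (lee1n 2) hL.
exists x; apply/cvgr0Pnorm_le => r r0.
have [N NP] := key r r0; exists N => // n /= /NP.
rewrite ger0_norm ?(sdot_ge0 ipP)// -[in X in _ -> X]lee_fin Lfun_dotE.
apply: le_trans; rewrite le_eqVlt; apply/orP; left; apply/eqP.
by apply: eq_integral => t _; rewrite -expr2 -sqrrN opprB.
Qed.

End L2_form.

Lemma ge0_integral_mrestr d (T : measurableType d) (R : realType)
    (mu : {measure set T -> \bar R}) (D : set T) (mD : measurable D)
    (f : T -> \bar R) : measurable_fun setT f -> (forall t, (0 <= f t)%E) ->
  (\int[mrestr mu mD]_t f t = \int[mu]_(t in D) f t)%E.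
Proof.
move=> mf f0; rewrite -(setUv D) ge0_integral_setU//; last 3 first.
- exact: measurableC.
- by rewrite setUv.
- exact/disj_setPCl.
rewrite [X in (_ + X)%E]null_set_integral ?adde0; last 3 first.
- exact: measurableC.
- exact: measurable_funTS.
- by rewrite /= /mrestr/= setICl measure0.
by apply: eq_measure_integral => A mA AD; rewrite /= /mrestr/= setIidl.
Qed.

Section L2_classes.
Context d (T : measurableType d) (R : realType).
Variable mu : {measure set T -> \bar R}.
Local Notation V := (LfunType mu (lee1n 2)).

Lemma Lfun_dot_ae0 (f : V) : Lfun_dot f f = 0 <-> {ae mu, forall t, f t = 0}.
Proof.
have h : (\int[mu]_t `|(f t ^+ 2)%R%:E| = (Lfun_dot f f)%:E)%E.
  rewrite Lfun_dotE; apply: eq_integral => t _.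
  by rewrite gee0_abs ?lee_fin ?sqr_ge0// expr2.
have mf : measurable_fun setT (EFin \o (fun t => f t ^+ 2)).
  by apply/measurable_EFinP/measurable_funX.
have := ae_eq_integral_abs mu measurableT mf; rewrite h => {}h; split.
  move=> f0; have /h : (Lfun_dot f f)%:E = 0%E by rewrite f0.
  by apply: filterS => t /(_ I) [/eqP]; rewrite sqrf_eq0 => /eqP.
move=> f0; apply/eqP; rewrite -eqe; apply/eqP/h.
by apply: filterS f0 => t ft _ /=; rewrite ft expr0n.
Qed.

Lemma L2_mem (x : LspaceType2 mu) : (x : T -> R) \in Lfun mu 2%:E.
Proof.
rewrite inE; apply/andP; split; rewrite inE/=; last exact: Lebesgue_finite.
exact: (measurable_funPT (repr (x : {mfun_ mu, T >-> measurableTypeR R}))).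
Qed.

Definition L2rep (x : LspaceType2 mu) : V := Lfun_Sub (lee1n 2) (L2_mem x).

Local Open Scope quotient_scope.

(** The equality holds only up to a null function: the representative chosen for
    the class of f may differ from f on a negligible set. *)
Lemma L2rep_surj (f : V) : exists x : LspaceType2 mu,
  Lfun_dot (L2rep x - f) (L2rep x - f) = 0.
Proof.
have mf : @measurable_fun _ _ T (measurableTypeR R) setT f.
  exact: (measurable_funPT f).
pose g : {mfun_ mu, T >-> measurableTypeR R} :=
  \pi_({mfun_ mu, T >-> measurableTypeR R})
    (@mfun_Sub _ _ T (measurableTypeR R) f (mem_set mf)).
have gf : {ae mu, forall t, (g : T -> R) t = f t}.
  have : \pi_({mfun_ mu, T >-> measurableTypeR R}) (repr g) = g by rewrite reprK.
  by move=> /eqP; rewrite eqmodE => /asboolP; apply: filterS => t; apply.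
have mg : measurable_fun setT (g : T -> R) by exact: (measurable_funPT (repr g)).
have g2 : (g : T -> R) \in Lfun mu 2%:E.
  apply: mem_Lfun2 => //.
  have /integrable_lty -/(_ measurableT) := Lfun2_integrable_sqr (LfunP f).
  apply: le_lt_trans; rewrite le_eqVlt; apply/orP; left; apply/eqP.
  apply: ge0_ae_eq_integral => //.
  - exact/measurable_EFinP/measurable_funX.
  - exact/measurable_EFinP/measurable_funX.
  - by move=> t _; rewrite lee_fin sqr_ge0.
  - by move=> t _; rewrite lee_fin sqr_ge0.
  - by apply: filterS gf => t gt _ /=; rewrite gt.
have gfin : finite_norm mu 2%:E (g : T -> R).
  by move: g2; rewrite inE => /andP[_]; rewrite inE.
exists (LebesgueSpace.Pack (LebesgueSpace.Class
  (@isFinLebesgue.Axioms_ _ _ _ _ _ (lee1n 2) _ gfin))).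
apply/Lfun_dot_ae0; apply: filterS gf => t gt.
by rewrite -[LHS]/((g : T -> R) t - f t) gt subrr.
Qed.

End L2_classes.

(** * Restrictions and the weighted norm *)

Section Lfun_restriction.
Context d (T : measurableType d) (R : realType).
Variable mu : {measure set T -> \bar R}.
Local Notation V := (LfunType mu (lee1n 2)).

Lemma Lfun_restr_subproof (A : set T) (mA : measurable A) (f : V) :
  (f : T -> R) \_ A \in Lfun mu 2%:E.
Proof.
have mf : measurable_fun setT ((f : T -> R) \_ A).
  by apply/(measurable_restrictT _ mA)/measurable_funTS; exact: measurable_funPT.
apply: mem_Lfun2 => //.
have /integrable_lty -/(_ measurableT) := Lfun2_integrable_sqr (LfunP f).
apply: le_lt_trans; apply: ge0_le_integral => //.
- by move=> t _; rewrite lee_fin sqr_ge0.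
- exact/measurable_EFinP/measurable_funX.
- exact/measurable_EFinP/measurable_funX.
- move=> t _; rewrite lee_fin patchE; case: ifP => // _.
  by rewrite expr0n sqr_ge0.
Qed.

Definition Lfun_restr (A : set T) (mA : measurable A) (f : V) : V :=
  Lfun_Sub (lee1n 2) (Lfun_restr_subproof mA f).

Lemma Lfun_restrE (A : set T) (mA : measurable A) (f : V) t :
  Lfun_restr mA f t = if t \in A then f t else 0.
Proof. exact: patchE. Qed.

Lemma Lfun_restrB (A : set T) (mA : measurable A) (f g : V) :
  Lfun_restr mA (f - g) = Lfun_restr mA f - Lfun_restr mA g.
Proof.
apply/LfuneqP => t.
rewrite -[RHS]/(Lfun_restr mA f t - Lfun_restr mA g t) !Lfun_restrE.
by case: ifP => // _; rewrite subrr.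
Qed.

(** Restriction to A is idempotent and selfadjoint. *)
Lemma Lfun_dot_restr (A : set T) (mA : measurable A) (f g : V) :
  Lfun_dot f (Lfun_restr mA g) = Lfun_dot (Lfun_restr mA f) (Lfun_restr mA g).
Proof.
apply: eq_Rintegral => t _; rewrite !Lfun_restrE.
by case: ifP => // _; rewrite !mulr0.
Qed.

Lemma Lfun_dot_restrC (A : set T) (mA : measurable A) (mA' : measurable (~` A)) (f : V) :
  Lfun_dot f f = Lfun_dot (Lfun_restr mA f) (Lfun_restr mA f) +
                 Lfun_dot (Lfun_restr mA' f) (Lfun_restr mA' f).
Proof.
rewrite /Lfun_dot -RintegralD//; [|exact: Lfun_mul_integrable..].
apply: eq_Rintegral => t _; rewrite !Lfun_restrE in_setC.
by case: ifP => _ /=; rewrite mulr0 ?addr0 ?add0r.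
Qed.

End Lfun_restriction.

Section weighted.
Context (R : realType) (n : nat) (Omega : set (Rn R n)) (mOmega : measurable Omega).
Local Notation mu := (lebesgue_on mOmega).
Local Notation V := (LfunType mu (lee1n 2)).

Lemma Lfun_dot_restr_lebesgue (A : set (Rn R n)) (mA : measurable A) (f : V) :
  (Lfun_dot (Lfun_restr mA f) (Lfun_restr mA f))%:E =
  (\int[lebesgue_Rn R n]_(t in Omega `&` A) (`|f t| ^+ 2)%R%:E)%E.
Proof.
rewrite integral_mkcondr Lfun_dotE /lebesgue_on ge0_integral_mrestr.
- apply: eq_integral => t _; rewrite !Lfun_restrE patchE.
  by case: ifP => _; rewrite ?mulr0// real_normK ?num_real.
- by apply/measurable_EFinP/measurable_funM.
- by move=> t; rewrite lee_fin -expr2 sqr_ge0.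
Qed.

Lemma L2distE (x y : L2 mOmega) :
  L2dist x y = Num.sqrt (Lfun_dot (L2rep x - L2rep y) (L2rep x - L2rep y)).
Proof.
rewrite /L2dist /L2norm unlock.
have -> : (\int[mu]_t (`|(EFin \o (fun t => x t - y t)%R) t| `^ 2) =
    (Lfun_dot (L2rep x - L2rep y) (L2rep x - L2rep y))%:E)%E.
  rewrite Lfun_dotE; apply: eq_integral => t _ /=.
  by rewrite powR_mulrn// real_normK ?num_real.
by rewrite poweR_EFin /= powR12_sqrt// (sdot_ge0 (semi_dot_Lfun mu)).
Qed.

Context (S : set (Rn R n)) (mS : measurable S) (SOmega : S `<=` Omega).

Lemma supported_inP (x : L2 mOmega) : supported_in S x <->
  Lfun_dot (Lfun_restr (measurableC mS) (L2rep x))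
           (Lfun_restr (measurableC mS) (L2rep x)) = 0.
Proof.
have mD : measurable (Omega `\` S) by exact: measurableD.
have mx : measurable_fun (Omega `\` S) (EFin \o (fun t => `|x t| ^+ 2)).
  apply/measurable_EFinP/measurable_funX/measurableT_comp => //.
  exact: measurable_funTS (measurable_funPT (L2rep x)).
have := ae_eq_integral_abs (lebesgue_Rn R n) mD mx.
rewrite (_ : integral _ _ _ = (Lfun_dot (Lfun_restr (measurableC mS) (L2rep x))
    (Lfun_restr (measurableC mS) (L2rep x)))%:E); last first.
  rewrite Lfun_dot_restr_lebesgue -setDE; apply: eq_integral => t _.
  by rewrite gee0_abs// lee_fin sqr_ge0.
move=> h; split=> [x0|x0].
- apply/eqP; rewrite -eqe; apply/eqP/h.
  by apply: filterS x0 => t xt Dt /=; rewrite xt// normr0 expr0n.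
- have /h : (Lfun_dot (Lfun_restr (measurableC mS) (L2rep x))
    (Lfun_restr (measurableC mS) (L2rep x)))%:E = 0%E by rewrite x0.
  by apply: filterS => t xt /xt [/eqP]; rewrite sqrf_eq0 normr_eq0 => /eqP.
Qed.

Lemma weighted_norm_sqr (a : R) (x y : L2 mOmega) : 0 <= a ->
  weighted_norm Omega S a (fun t => x t - y t) ^+ 2 =
  a * Lfun_dot (Lfun_restr mS (L2rep x - L2rep y))
               (Lfun_restr mS (L2rep x - L2rep y)) +
  Lfun_dot (Lfun_restr (measurableC mS) (L2rep x - L2rep y))
           (Lfun_restr (measurableC mS) (L2rep x - L2rep y)).
Proof.
have dotE A (mA : measurable A) : Lfun_dot (Lfun_restr mA (L2rep x - L2rep y))
    (Lfun_restr mA (L2rep x - L2rep y)) =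
    \int[lebesgue_Rn R n]_(t in Omega `&` A) (`|x t - y t| ^+ 2).
  by rewrite /Rintegral -(Lfun_dot_restr_lebesgue mA (L2rep x - L2rep y)).
move=> a0; rewrite !dotE (setIidr SOmega) -setDE.
rewrite sqr_sqrtr// addr_ge0// ?mulr_ge0//; exact: Rintegral_ge0.
Qed.

End weighted.

(** * Minimizers of the Tikhonov functional *)

(** This makes the Cauchy-Schwarz inequality, stated for semidefinite forms,
    available in the Hilbert space of the data. *)
Lemma semi_dot_dot (R : realType) (Y : normedModType R) (dot : {dot Y for idfun}) :
  norm_from_dot dot -> semi_dot dot.
Proof.
move=> dotE; split.
- by move=> u v; have := hermC dot u v; rewrite expr0 mul1r.
- by move=> a u w v; rewrite linearPl.
- by move=> u; rewrite -dotE sqr_ge0.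
Qed.

Lemma L2cvgP (R : realType) (n : nat) (Omega : set (Rn R n))
    (mOmega : measurable Omega) (u : nat -> L2 mOmega) (x : L2 mOmega) :
  L2cvg u x <-> Lfun_dot (L2rep (u k) - L2rep x) (L2rep (u k) - L2rep x)
                  @[k --> \oo] --> 0.
Proof.
have ipP := semi_dot_Lfun (lebesgue_on mOmega).
rewrite /L2cvg; under eq_fun do rewrite L2distE; split=> [h|h].
- rewrite -(mulr0 0); under eq_fun => k do rewrite -(sqr_sqrtr (sdot_ge0 ipP _)).
  exact: cvgM.
- by rewrite -sqrtr0; apply: (cvg_comp _ _ h); exact: sqrt_continuous.
Qed.

Section regularized_solutions.
Context (R : realType) (n : nat) (Omega : set (Rn R n)) (mOmega : measurable Omega)
  (S : set (Rn R n)) (mS : measurable S) (SOmega : S `<=` Omega)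
  (Y : completeNormedModType R) (dot : {dot Y for idfun})
  (dotE : norm_from_dot dot)
  (D : set (L2 mOmega)) (F : L2 mOmega -> Y)
  (Fclosed : weakly_sequentially_closed D F dot)
  (y : Y) (xstar : L2 mOmega) (xstarS : supported_in S xstar)
  (xdag : L2 mOmega)
  (xdag_min : minimum_norm_solution D F y S xstar xdag).

Local Notation mu := (lebesgue_on mOmega).
Local Notation ip := (@Lfun_dot _ _ _ mu).
Local Notation inn := (Lfun_restr mS).
Local Notation out := (Lfun_restr (measurableC mS)).
Local Notation ipP := (semi_dot_Lfun mu).
Local Notation offset x := (L2rep x - L2rep xstar).
Local Notation r := (ip (offset xdag) (offset xdag)).

Lemma out_offset_null (x : L2 mOmega) :
  supported_in S x <-> ip (out (offset x)) (out (offset x)) = 0.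
Proof.
move/(supported_inP mS) : xstarS => s0.
rewrite (supported_inP mS) Lfun_restrB (sdot_sqrB ipP) s0.
by rewrite (sdotC ipP) (sdot_null ipP _ s0) mulr0 subr0 addr0.
Qed.

(** The first term of the functional at x^dag is at most delta^2, and its penalty
    is alpha * r as x^dag - x^* vanishes outside S; each bound drops nonnegative
    terms of the functional at x. *)
Lemma tikhonov_minimizer_bounds (yd : Y) (delta alpha : R) (x : L2 mOmega) :
  `|y - yd| <= delta -> 0 < alpha ->
  tikhonov_minimizer D F yd S alpha xstar x ->
  [/\ `|F x - yd| ^+ 2 <= delta ^+ 2 + alpha * r,
      ip (out (offset x)) (out (offset x)) <= delta ^+ 2 + alpha * r &
      ip (offset x) (offset x) <=
        r + (delta ^+ 2 / alpha + (delta ^+ 2 + alpha * r))].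
Proof.
move=> yyd alpha0 [_ /(_ xdag)]; have [[Dxdag Fxdag xdagS] _] := xdag_min.
move=> /(_ Dxdag); rewrite /tikhonov !(weighted_norm_sqr mS SOmega _ _ (ltW alpha0)) Fxdag.
have xdag0 := (out_offset_null xdag).1 xdagS.
rewrite [X in _ <= _ + (_ + X)]xdag0.
have yyd2 : `|y - yd| ^+ 2 <= delta ^+ 2 by rewrite lerXn2r ?nnegrE// (le_trans _ yyd).
have rE := Lfun_dot_restrC mS (measurableC mS) (offset xdag).
rewrite xdag0 addr0 in rE.
rewrite -rE (Lfun_dot_restrC mS (measurableC mS) (offset x)).
have i0 := sdot_ge0 ipP (inn (offset x)).
have o0 := sdot_ge0 ipP (out (offset x)).
have f0 : 0 <= `|F x - yd| ^+ 2 by exact: sqr_ge0.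
move: yyd2 i0 o0 f0.
move: (ip (inn _) _) (ip (out _) _) (ip (offset xdag) _) (`|_| ^+ 2) (`|_| ^+ 2).
move=> i o q f e yyd2 i0 o0 f0 H.
have ai0 : 0 <= alpha * i by rewrite mulr_ge0// ltW.
split; [lra|lra|].
have : i <= q + delta ^+ 2 / alpha.
  by rewrite -(ler_pM2l alpha0) mulrDr [X in _ + X]mulrC divfK ?gt_eqF//; lra.
lra.
Qed.

Context (ydelta : R -> Y)
  (ydeltaP : forall delta : R, 0 < delta -> `|y - ydelta delta| <= delta)
  (alpha : R -> R)
  (alpha_gt0 : forall delta : R, 0 < delta -> 0 < alpha delta)
  (alpha_cvg0 : alpha delta @[delta --> 0^'+] --> 0)
  (delta2_alpha_cvg0 : delta ^+ 2 / alpha delta @[delta --> 0^'+] --> 0).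

Section sequence.
Context (delta_ : nat -> R) (x_ : nat -> L2 mOmega)
  (delta_gt0 : forall k, 0 < delta_ k)
  (delta_cvg0 : delta_ k @[k --> \oo] --> 0)
  (x_min : forall k, tikhonov_minimizer D F (ydelta (delta_ k)) S
                       (alpha (delta_ k)) xstar (x_ k)).

Let bounds k := tikhonov_minimizer_bounds (ydeltaP (delta_gt0 k))
  (alpha_gt0 (delta_gt0 k)) (x_min k).

Let eta k := delta_ k ^+ 2 + alpha (delta_ k) * r.

Lemma eta_cvg0 : eta k @[k --> \oo] --> 0.
Proof.
have a0 : alpha (delta_ k) @[k --> \oo] --> 0.
  by move/cvg_at_rightP : alpha_cvg0; apply.
have h := cvgD (cvgM delta_cvg0 delta_cvg0) (cvgM a0 (cvg_cst r)).
by rewrite mulr0 mul0r addr0 in h; exact: h.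
Qed.

Let eps k := delta_ k ^+ 2 / alpha (delta_ k) + eta k.

Lemma eps_cvg0 : eps k @[k --> \oo] --> 0.
Proof.
have h : delta_ k ^+ 2 / alpha (delta_ k) @[k --> \oo] --> 0.
  by move/cvg_at_rightP : delta2_alpha_cvg0; apply.
by have {}h := cvgD h eta_cvg0; rewrite addr0 in h; exact: h.
Qed.

(** Testing the weak convergence of x_k - x^* against the outer part of its limit
    shows that this part is null, since the outer parts of x_k - x^* tend to 0 in
    norm: their penalty does not carry the factor alpha. So x is supported in S,
    which bounds |x - x^*| from below by minimality of x^dag, and [radon_riesz]
    turns the upper bound on |x_k - x^*| into strong convergence. *)
Lemma weak_limit_minimum_norm (x : L2 mOmega) :
  (forall v, ip (L2rep (x_ k)) v @[k --> \oo] --> ip (L2rep x) v) ->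
  minimum_norm_solution D F y S xstar x /\ L2cvg x_ x.
Proof.
move=> x_x.
have z_z v : ip (offset (x_ k)) v @[k --> \oo] --> ip (offset x) v.
  under eq_fun do rewrite (sdotBl ipP).
  by rewrite (sdotBl ipP); apply: cvgB => //; exact: cvg_cst.
have Fx_y : `|F (x_ k) - y| @[k --> \oo] --> 0.
  have h : Num.sqrt (eta k) + delta_ k @[k --> \oo] --> 0.
    rewrite -[X in _ --> X](addr0 0); apply: cvgD => //; rewrite -sqrtr0.
    by apply: (cvg_comp _ _ eta_cvg0); exact: sqrt_continuous.
  apply: (squeeze_cvgr _ (cvg_cst 0) h); apply: filterE => k.
  rewrite normr_ge0/= (le_trans (ler_distD (ydelta (delta_ k)) _ _))// lerD//.
    by rewrite -(ger0_norm (normr_ge0 _)) -sqrtr_sqr ler_wsqrtr//; case: (bounds k).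
  by rewrite distrC ydeltaP.
have [Dx Fx] : D x /\ F x = y.
  apply: (Fclosed (u := x_)).
  - by move=> k; have [] := x_min k.
  - by move=> g; exact: x_x (L2rep g).
  - move=> w; apply: (cvg_sdotl (semi_dot_dot dotE)).
    under eq_fun do rewrite -dotE.
    by rewrite -(mulr0 0); exact: (cvgM Fx_y Fx_y).
have xS : supported_in S x.
  apply/out_offset_null; rewrite -Lfun_dot_restr.
  apply: (cvg_unique (@norm_hausdorff _ R) (z_z _)) => /=.
  under eq_fun do rewrite Lfun_dot_restr.
  apply: (sdot_cvg_null ipP).
  apply: (squeeze_cvgr _ (cvg_cst 0) eta_cvg0); apply: filterE => k.
  by rewrite (sdot_ge0 ipP); case: (bounds k).
have [_ xdag_le] := xdag_min.
have r_le : r <= ip (offset x) (offset x).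
  have := xdag_le x (And3 Dx Fx xS); rewrite !L2distE.
  by rewrite ler_sqrt// (sdot_ge0 ipP).
have [qx z_cvg] : ip (offset x) (offset x) = r /\
    ip (offset (x_ k) - offset x) (offset (x_ k) - offset x) @[k --> \oo] --> 0.
  apply: (radon_riesz ipP z_z _ eps_cvg0 r_le) => k.
  by case: (bounds k).
split.
  split=> // x' /xdag_le; apply: le_trans.
  by rewrite !L2distE qx.
apply/L2cvgP; move: z_cvg; congr (_ @[k --> \oo] --> 0).
by apply/funext => k; rewrite opprB addrA subrK.
Qed.

(** The weak limit is obtained for the offsets, in the space of functions, and then
    translated back and replaced by a representative of its class. *)
Lemma minimizers_weak_subseq : exists2 phi : nat -> nat,
  {homo phi : i j / (i < j)%N} &
  exists x : L2 mOmega, forall v,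
    ip (L2rep (x_ (phi k))) v @[k --> \oo] --> ip (L2rep x) v.
Proof.
have [M qM] : exists M, forall k, ip (offset (x_ k)) (offset (x_ k)) <= M.
  have [M0 [_ /(_ (M0 + 1))]] := cvg_seq_bounded (cvgP _ eps_cvg0).
  rewrite ltrDl ltr01 => /(_ isT) epsM.
  exists (r + (M0 + 1)) => k; have [_ _] := bounds k; move=> /le_trans; apply.
  by rewrite lerD2l (le_trans (ler_norm _))//; exact: epsM.
have [phi phi_homo [z zP]] := weak_sequential_compactness ipP
  (@Lfun_complete _ _ _ mu) qM.
exists phi => //; have [x xz] := L2rep_surj (z + L2rep xstar).
exists x => v; have xv : ip (L2rep x) v = ip z v + ip (L2rep xstar) v.
  by apply/eqP; rewrite -(sdotDl ipP) -subr_eq0 -(sdotBl ipP) (sdot_null ipP _ xz).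
rewrite xv; have -> : (fun k => ip (L2rep (x_ (phi k))) v) =
    (fun k => ip (offset (x_ (phi k))) v + ip (L2rep xstar) v).
  by apply/funext => k; rewrite -(sdotDl ipP) subrK.
by apply: cvgD; [exact: zP|exact: cvg_cst].
Qed.

End sequence.
End regularized_solutions.

Theorem theoremA3 (R : realType) (n : nat)
  (Omega : set (Rn R n)) (mOmega : measurable Omega)
  (bOmega : bounded_set (Omega : set 'rV[R]_n))
  (S : set (Rn R n)) (mS : measurable S) (SOmega : S `<=` Omega)
  (Y : completeNormedModType R) (dot : {dot Y for idfun})
  (dotE : norm_from_dot dot)
  (D : set (L2 mOmega)) (F : L2 mOmega -> Y)
  (Fcont : operator_continuous D F)
  (Fclosed : weakly_sequentially_closed D F dot)
  (y : Y) (xstar : L2 mOmega) (xstarS : supported_in S xstar)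
  (xdag : L2 mOmega)
  (xdag_min : minimum_norm_solution D F y S xstar xdag)
  (ydelta : R -> Y)
  (ydeltaP : forall delta : R, 0 < delta -> `|y - ydelta delta| <= delta)
  (alpha : R -> R)
  (alpha_gt0 : forall delta : R, 0 < delta -> 0 < alpha delta)
  (alpha_cvg0 : alpha delta @[delta --> 0^'+] --> 0)
  (delta2_alpha_cvg0 : delta ^+ 2 / alpha delta @[delta --> 0^'+] --> 0) :
  (forall (delta_ : nat -> R) (x_ : nat -> L2 mOmega),
     (forall k, 0 < delta_ k) ->
     delta_ k @[k --> \oo] --> 0 ->
     (forall k, tikhonov_minimizer D F (ydelta (delta_ k)) S
                  (alpha (delta_ k)) xstar (x_ k)) ->
     (exists (phi : nat -> nat) (x : L2 mOmega),
        {homo phi : i j / (i < j)%N} /\ L2cvg (x_ \o phi) x) /\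
     (forall (phi : nat -> nat) (x : L2 mOmega),
        {homo phi : i j / (i < j)%N} -> L2cvg (x_ \o phi) x ->
        minimum_norm_solution D F y S xstar x)) /\
  ((forall x, minimum_norm_solution D F y S xstar x -> x = xdag) ->
   forall xdelta : R -> L2 mOmega,
     (forall delta : R, 0 < delta ->
        tikhonov_minimizer D F (ydelta delta) S (alpha delta) xstar
          (xdelta delta)) ->
     L2dist (xdelta delta) xdag @[delta --> 0^'+] --> 0).
Proof.
have ipP := semi_dot_Lfun (lebesgue_on mOmega).
have subseq (delta_ : nat -> R) (x_ : nat -> L2 mOmega) :
    (forall k, 0 < delta_ k) -> delta_ k @[k --> \oo] --> 0 ->
    (forall k, tikhonov_minimizer D F (ydelta (delta_ k)) S
                 (alpha (delta_ k)) xstar (x_ k)) ->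
    (exists (phi : nat -> nat) (x : L2 mOmega),
       {homo phi : i j / (i < j)%N} /\ L2cvg (x_ \o phi) x) /\
    (forall (phi : nat -> nat) (x : L2 mOmega),
       {homo phi : i j / (i < j)%N} -> L2cvg (x_ \o phi) x ->
       minimum_norm_solution D F y S xstar x).
  move=> delta_gt0 delta_cvg0 x_min.
  have weak_limit (phi : nat -> nat) (x : L2 mOmega) :
      {homo phi : i j / (i < j)%N} ->
      (forall v, Lfun_dot (L2rep (x_ (phi k))) v @[k --> \oo] -->
                 Lfun_dot (L2rep x) v) ->
      minimum_norm_solution D F y S xstar x /\ L2cvg (x_ \o phi) x.
    move=> phi_homo.
    apply: (weak_limit_minimum_norm mS SOmega dotE Fclosed xstarS xdag_min
      ydeltaP alpha_gt0 alpha_cvg0 delta2_alpha_cvg0 (delta_ := delta_ \o phi)).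
    - by move=> k; exact: delta_gt0.
    - exact: (cvg_comp_homo phi_homo delta_cvg0).
    - by move=> k; exact: x_min.
  split=> [|phi x phi_homo /L2cvgP x_cvg].
    have [phi phi_homo [x x_weak]] := minimizers_weak_subseq mS SOmega xstarS
      xdag_min ydeltaP alpha_gt0 alpha_cvg0 delta2_alpha_cvg0
      delta_gt0 delta_cvg0 x_min.
    by exists phi, x; split=> //; have [] := weak_limit _ _ phi_homo x_weak.
  have x_weak v : Lfun_dot (L2rep (x_ (phi k))) v @[k --> \oo] -->
      Lfun_dot (L2rep x) v.
    exact: (cvg_sdotl ipP (u := fun k => L2rep (x_ (phi k)))).
  exact: (weak_limit phi x phi_homo x_weak).1.
split=> // xdag_unique xdelta xdelta_min.
apply/cvg_at_rightP => u [u_gt0 u_cvg0].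
apply: contrapT => /not_cvg_subseq[phi phi_homo [e e_gt0 far]].
have [|||[psi [x [psi_homo x_cvg]]] x_limit] :=
  subseq (u \o phi) (xdelta \o u \o phi).
- by move=> k; exact: u_gt0.
- exact: (cvg_comp_homo phi_homo u_cvg0).
- by move=> k; exact/xdelta_min/u_gt0.
have xE := xdag_unique _ (x_limit _ _ psi_homo x_cvg).
move: x_cvg; rewrite xE => /cvgr0Pnorm_lt/(_ e e_gt0)/filter_ex[k].
by rewrite ltNge; move/negP; apply; exact: far.
Qed.
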